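(* Let $G=(V,E)$ be a matching-covered graph. Then the following statements are equivalent: (1) $G$ is bipartite; (2) the set of non-feasible edge sets of $G$ equals $\{X\subseteq E: X\sim_G \emptyset\}$; (3) the set of non-feasible edge sets of $G$ equals $\{X\subseteq E: X\sim_G E\}$.
   Context: Graphs are finite, undirected and loopless. A perfect matching of $G$ is a set of independent edges covering all vertices. $G$ is matching-covered if it is connected and every edge lies in some perfect matching of $G$. An edge set $X\subseteq E$ is feasible if there are perfect matchings $M_1,M_2$ of $G$ with $|M_1\cap X|\not\equiv |M_2\cap X| \pmod 2$; otherwise $X$ is non-feasible. For $V_0\subseteq V$, $\nabla_G(V_0)$ denotes the set of edges of $G$ with exactly one end in $V_0$. For $X,Y\subseteq E$, $X\sim_G Y$ (switching-equivalent) means $X=Y\oplus \nabla_G(V_0)$ for some $V_0\subseteq V$, where $\oplus$ is symmetric difference. *)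

(* Defs.v *)
From mathcomp Require Import all_boot.
Set Implicit Arguments.
Unset Strict Implicit.
Unset Printing Implicit Defensive.

(* Finite undirected graphs. Parallel edges are allowed, since distinct edges
   may have the same set of ends; loops are excluded because every edge has
   exactly two distinct ends. *)
Record graph := Graph {
  vertex : finType;
  edge : finType;
  ends : edge -> {set vertex};
  card_ends : forall e, #|ends e| = 2
}.

Section GraphDefs.

Variable G : graph.
Implicit Types (M X Y : {set edge G}) (A : {set vertex G}).

Definition adjacent : rel (vertex G) :=
  fun u v => [exists e : edge G, ends e == [set u; v]].

Definition connected_graph : bool :=
  [forall u, forall v, connect adjacent u v].

Definition independent_edges M : bool :=
  [forall e in M, forall f in M, (e != f) ==> [disjoint ends e & ends f]].

Definition perfect_matching M : bool :=
  independent_edges M && [forall v, exists e in M, v \in ends e].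

Definition matching_covered : bool :=
  connected_graph && [forall e, exists M, perfect_matching M && (e \in M)].

Definition bipartite : bool :=
  [exists A : {set vertex G},
    [forall e : edge G, ~~ (ends e \subset A) && ~~ (ends e \subset ~: A)]].

Definition feasible X : bool :=
  [exists M1, exists M2,
    [&& perfect_matching M1, perfect_matching M2
      & #|M1 :&: X| != #|M2 :&: X| %[mod 2]]].

Definition nonfeasible_sets : {set {set edge G}} := [set X | ~~ feasible X].

Definition nabla A : {set edge G} := [set e | #|ends e :&: A| == 1].

Definition symdiff X Y : {set edge G} := (X :\: Y) :|: (Y :\: X).

Definition switching_equiv X Y : bool :=
  [exists A, X == symdiff Y (nabla A)].

End GraphDefs.

Arguments bipartite : clear implicits.
Arguments connected_graph : clear implicits.
Arguments matching_covered : clear implicits.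
Arguments nonfeasible_sets : clear implicits.

(* Main.v *)
Require Import Defs.
From mathcomp Require Import all_boot.

(** A cut meets every perfect matching in as many edges as the parity of its
    shore dictates, so cuts are non-feasible, and so is [E].  Hence (2) and (3)
    both force [E] to be a cut.

    Conversely, let [G] be bipartite with colour classes [A] and [B] and fix a
    perfect matching [M].  Contracting [M] and orienting every edge from [A] to
    [B] gives a digraph whose directed cycles are the [M]-alternating cycles.
    Every arc lies on a directed cycle, because it belongs to some perfect
    matching, which permutes the nodes.  If [X] is non-feasible, then every
    directed cycle has even weight, where an arc [e] weighs
    [e \in X] plus [f \in X] for the matching edge [f] at the tail of [e].  So
    the weight is the coboundary of a potential, and that potential yields a
    vertex set whose cut is [X]. *)

Set Implicit Arguments.
Unset Strict Implicit.
Unset Printing Implicit Defensive.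

Lemma odd_count_addb (T : Type) (a b : pred T) (s : seq T) :
  odd (count (fun x => a x (+) b x) s) = odd (count a s) (+) odd (count b s).
Proof.
by elim: s => //= x s IHs; rewrite !oddD IHs !oddb addbACA.
Qed.

Lemma uniq_map_inj_in (T U : eqType) (f : T -> U) (s : seq T) :
  uniq (map f s) -> {in s &, injective f}.
Proof.
elim: s => //= x s IHs /andP[fx /IHs inj_s] y z; rewrite !inE.
case/predU1P=> [-> | ys]; case/predU1P=> [-> | zs] //; last exact: inj_s.
  by move=> eq_f; case/negP: fx; rewrite eq_f map_f.
by move=> eq_f; case/negP: fx; rewrite -eq_f map_f.
Qed.

Lemma card_imset_seqI (T U : finType) (f : T -> U) (s : seq T) (X : {set U}) :
  uniq (map f s) -> #|[set f x | x in s] :&: X| = count (fun x => f x \in X) s.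
Proof.
move=> Us; rewrite -[RHS](count_map f (mem X)) -size_filter.
rewrite -(card_uniqP (filter_uniq _ Us)).
apply: eq_card => y; rewrite inE mem_filter andbC; congr (_ && _).
by apply/imsetP/mapP => -[x xs ->]; exists x.
Qed.

(** * Potentials on digraphs *)

Section Digraph.

Variables (N E : finType) (src tgt : E -> N).
Implicit Types (a b : N) (s : seq E) (w : pred E).

Fixpoint walk a s : bool :=
  if s is e :: s' then (src e == a) && walk (tgt e) s' else true.

Definition walk_end a s : N := last a (map tgt s).

Definition arc : rel N := fun a b => [exists e, (src e == a) && (tgt e == b)].

Lemma walk_cat a s1 s2 :
  walk a (s1 ++ s2) = walk a s1 && walk (walk_end a s1) s2.
Proof. by elim: s1 a => //= e s1 IHs a; rewrite IHs andbA. Qed.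

Lemma walk_end_cat a s1 s2 :
  walk_end a (s1 ++ s2) = walk_end (walk_end a s1) s2.
Proof. by rewrite /walk_end map_cat last_cat. Qed.

Lemma connect_walk a b :
  connect arc a b -> exists s, walk a s && (walk_end a s == b).
Proof.
move/connectP=> [p + ->]; elim: p a => [|c p IHp] a /=; first by exists [::] => /=.
case/andP=> /existsP[e /andP[/eqP ea /eqP ec]] /IHp[s ws].
by exists (e :: s); rewrite /= ea eqxx ec /walk_end /= ec.
Qed.

(** Both lists run through the same cyclic sequence of nodes, the second starting one place
    later. *)
Lemma closed_walk_perm a s :
  walk a s -> walk_end a s = a -> perm_eq (map src s) (map tgt s).
Proof.
move=> ws es.
have tgt_src : a :: map tgt s = rcons (map src s) (walk_end a s).
  by elim: s a ws {es} => //= e s IHs a /andP[/eqP-> /IHs <-].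
by rewrite -(perm_cons a) tgt_src es perm_sym perm_rcons.
Qed.

(** Induction on a bound for the length. A closed walk that leaves the same node twice splits there
    into two shorter closed walks, and their weights add up. *)
Lemma closed_walk_even w :
    (forall a s, walk a s -> walk_end a s = a -> uniq (map src s) ->
       ~~ odd (count w s)) ->
  forall a s, walk a s -> walk_end a s = a -> ~~ odd (count w s).
Proof.
move=> simple_even a s; move: {2}_.+1 (ltnSn (size s)) => n.
elim: n => // n IHn in a s *; rewrite ltnS => le_sn ws es.
have [Us|] := boolP (uniq (map src s)); first exact: simple_even ws es Us.
case/(uniqPn a) => i [j [lt_ij]]; rewrite size_map => lt_js.
have lt_is := ltn_trans lt_ij lt_js.
have e0 : E by case: (s) lt_is => [|e0].
rewrite !(nth_map e0) //.
set e1 := nth e0 s i; set e2 := nth e0 s j => eq_src.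
(* [s2] is the closed detour between the two departures from the repeated node; [s1 ++ s3] is the
   closed walk that skips it. *)
pose s1 := take i s; pose s2 := drop i (take j s); pose s3 := drop j s.
have def_s : s = s1 ++ s2 ++ s3.
  by rewrite /s1 -(take_takel s (ltnW lt_ij)) catA cat_take_drop cat_take_drop.
have [t2 def_s2] : exists t, s2 = e1 :: t.
  exists (behead s2); rewrite /s2 (drop_nth e0) ?nth_take //.
  by rewrite size_take lt_js.
have [t3 def_s3] : exists t, s3 = e2 :: t.
  by exists (behead s3); rewrite /s3 (drop_nth e0).
have := ws; rewrite def_s !walk_cat => /and3P[ws1 ws2 ws3].
have end1 : src e1 = walk_end a s1.
  by apply/eqP; move: ws2; rewrite def_s2 => /andP[].
have end2 : walk_end (walk_end a s1) s2 = walk_end a s1.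
  by apply/esym/eqP; move: ws3; rewrite -end1 eq_src def_s3 => /andP[].
have szs : size s = size s1 + (size s2 + size s3) by rewrite def_s !size_cat.
have sz2 : 0 < size s2 by rewrite def_s2.
have sz3 : 0 < size s3 by rewrite def_s3.
have even2 : ~~ odd (count w s2).
  apply: (IHn (walk_end a s1)) => //.
  apply: leq_trans le_sn.
  by rewrite szs addnCA -{1}[size s2]addn0 ltn_add2l addn_gt0 sz3 orbT.
have even13 : ~~ odd (count w (s1 ++ s3)).
  apply: (IHn a).
  - apply: leq_trans le_sn.
    by rewrite szs size_cat addnCA -{1}[_ + _]add0n ltn_add2r.
  - by rewrite walk_cat ws1 -end2.
  - by move: es; rewrite {1}def_s !walk_end_cat end2.
by move: even13; rewrite !count_cat !oddD (negPf even2) addFb.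
Qed.

(** Return paths make reachability symmetric, so each component has a root from which all its nodes
    are reached. The potential of a node is the parity of a chosen walk from the root; evenness of
    closed walks makes it independent of the choice. *)
Lemma potential_exists w :
    (forall e, connect arc (tgt e) (src e)) ->
    (forall a s, walk a s -> walk_end a s = a -> uniq (map src s) ->
       ~~ odd (count w s)) ->
  exists p : N -> bool, forall e, p (tgt e) = p (src e) (+) w e.
Proof.
move=> return_path /closed_walk_even closed_even.
have arc_sym : connect_sym arc.
  have sym1 a b : connect arc a b -> connect arc b a.
    move/connectP=> [p + ->]; elim: p a => //= c p IHp a.
    case/andP=> /existsP[e /andP[/eqP <- /eqP ec]] /IHp/connect_trans; apply.
    by rewrite -ec.
  by move=> a b; apply/idP/idP; apply: sym1.
have from_root a : exists s,
    walk (root arc a) s && (walk_end (root arc a) s == a).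
  by apply: connect_walk; rewrite arc_sym connect_root.
exists (fun a => odd (count w (xchoose (from_root a)))) => e.
case/andP: (xchooseP (from_root (src e))); case/andP: (xchooseP (from_root (tgt e))).
set q := xchoose _; set p := xchoose _ => wq /eqP eq wp /eqP ep.
have rt : root arc (src e) = root arc (tgt e).
  by apply/rootP => //; rewrite arc_sym.
(* The same return walk [s] closes both [q] and [p] followed by [e], so these two have equal
   parity. *)
have [s /andP[ws /eqP es]] := connect_walk (connect_root arc (tgt e)).
have := @closed_even (root arc (tgt e)) (q ++ s).
rewrite walk_cat wq eq ws walk_end_cat eq es => /(_ isT erefl).
rewrite rt in wp ep.
have := @closed_even (root arc (tgt e)) (p ++ e :: s).
rewrite walk_cat wp ep /= eqxx ws walk_end_cat ep /walk_end /= -/(walk_end _ _) es.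
move=> /(_ isT erefl); rewrite !count_cat /= !oddD oddb.
by case: (odd _); case: (odd _); case: (odd _); case: (w e).
Qed.

End Digraph.

(** * Matchings and cuts *)

Section Matchings.

Variable G : graph.
Implicit Types (M X Y : {set edge G}) (A B : {set vertex G}) (e f : edge G).

Lemma in_symdiff X Y e : (e \in symdiff X Y) = (e \in X) (+) (e \in Y).
Proof. by rewrite !inE; case: (e \in X); case: (e \in Y). Qed.

Lemma in_nabla2 A e u v :
  ends e = [set u; v] -> (e \in nabla A) = (u \in A) (+) (v \in A).
Proof.
move=> def_e; have := card_ends e; rewrite inE def_e cards2.
case: eqP => // /eqP neq_uv _.
have -> : #|[set u; v] :&: A| = (u \in A) + (v \in A).
  rewrite setIUl cardsU setIACA setIid (_ : [set u] :&: [set v] = set0); last first.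
    by apply/setP=> x; rewrite !inE; case: eqP => // ->; apply/negbTE.
  rewrite set0I cards0 subn0.
  have cI1 x : #|[set x] :&: A| = (x \in A).
    have [xA | xA] := boolP (x \in A); first by rewrite (setIidPl _) ?sub1set ?cards1.
    by apply/eqP; rewrite cards_eq0 setI_eq0 disjoints1.
  by rewrite !cI1.
by case: (u \in A); case: (v \in A).
Qed.

Lemma ends2 e : exists u v, ends e = [set u; v].
Proof.
by have /eqP/cards2P[u [v [_ ->]]] := card_ends e; exists u, v.
Qed.

Lemma odd_nabla A e : odd #|ends e :&: A| = (e \in nabla A).
Proof.
have : #|ends e :&: A| <= 2 by rewrite -(card_ends e) subset_leq_card ?subsetIl.
by rewrite inE; case: #|_| => [|[|[|]]].
Qed.

Lemma nabla_symdiff A B e :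
  (e \in nabla [set v | (v \in A) (+) (v \in B)])
    = (e \in nabla A) (+) (e \in nabla B).
Proof.
have [u [v def_e]] := ends2 e; rewrite !(in_nabla2 _ def_e) !inE.
by rewrite addbACA.
Qed.

Lemma bipartiteP :
  reflect (exists A, nabla A = [set: edge G]) (bipartite G).
Proof.
apply: (iffP existsP) => -[A cutA]; exists A.
  apply/setP=> e; have := forallP cutA e; have [u [v def_e]] := ends2 e.
  rewrite (in_nabla2 _ def_e) def_e !subUset !sub1set !inE.
  by case: (u \in A); case: (v \in A).
apply/forallP=> e; have : e \in nabla A by rewrite cutA inE.
have [u [v def_e]] := ends2 e.
rewrite (in_nabla2 _ def_e) def_e !subUset !sub1set !inE.
by case: (u \in A); case: (v \in A).
Qed.

Lemma perfect_matching_intro M :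
    (forall v, exists2 e, e \in M & v \in ends e) ->
    (forall v e f, e \in M -> f \in M -> v \in ends e -> v \in ends f -> e = f) ->
  perfect_matching M.
Proof.
move=> cov uniqM; apply/andP; split; last first.
  by apply/forallP=> v; have [e eM ve] := cov v; apply/existsP; exists e; rewrite eM.
apply/forall_inP=> e eM; apply/forall_inP=> f fM; apply/implyP.
by apply: contraR => /pred0Pn[v /andP[/= ve vf]]; apply/eqP/(uniqM v).
Qed.

(** The function [m] sends each vertex to the one edge of [M] that covers it; later arguments use a
    matching in this form. *)
Lemma perfect_matchingP M :
  reflect (exists m : vertex G -> edge G,
             forall v e, (e \in M) && (v \in ends e) = (e == m v))
          (perfect_matching M).
Proof.
apply: (iffP idP) => [/andP[indM /forallP covM] | [m mP]].
  have /fin_all_exists2[m mM mv] v : exists2 e, e \in M & v \in ends e.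
    by have /existsP[e /andP[]] := covM v; exists e.
  exists m => v e; apply/andP/eqP => [[eM ve] | ->]; last by rewrite mM mv.
  have /forall_inP/(_ _ (mM v))/implyP := forall_inP indM e eM.
  case: eqP => // _ /(_ isT) /pred0P/(_ v) /=.
  by rewrite ve mv.
apply: perfect_matching_intro => [v | v e f eM fM ve vf].
  by exists (m v); have := mP v (m v); rewrite eqxx => /andP[].
have /eqP-> : e == m v by rewrite -mP eM.
by apply/esym/eqP; rewrite -mP fM.
Qed.

(** The ends of the edges of [M] partition the vertices, so [A] can be counted edge by edge. *)
Lemma sum_matching_ends M A :
  perfect_matching M -> \sum_(e in M) #|ends e :&: A| = #|A|.
Proof.
case/perfect_matchingP=> m mP; rewrite -sum1_card.
rewrite (partition_big m (mem M)) /=; last first.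
  by move=> v _; have := mP v (m v); rewrite eqxx => /andP[].
apply: eq_bigr => e eM; rewrite -sum1_card; apply: eq_bigl => v.
by rewrite inE andbC; have := mP v e; rewrite eM eq_sym => <-.
Qed.

(** An edge of [M] has 0, 1 or 2 ends in [A], and exactly the edges of the cut contribute an odd
    number. *)
Lemma matching_nabla_odd M A :
  perfect_matching M -> odd #|M :&: nabla A| = odd #|A|.
Proof.
move=> /sum_matching_ends <-.
rewrite -sum1_card; under eq_bigl do rewrite in_setI; rewrite big_mkcondr /=.
elim/big_ind2: _ => // [m1 n1 m2 n2 IH1 IH2 | e eM].
  by rewrite !oddD IH1 IH2.
by rewrite odd_nabla; case: ifP.
Qed.

Lemma nonfeasibleP X :
  reflect (forall M1 M2, perfect_matching M1 -> perfect_matching M2 ->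
             odd #|M1 :&: X| = odd #|M2 :&: X|)
          (X \in nonfeasible_sets G).
Proof.
rewrite inE; apply: (iffP idP) => [nfX M1 M2 pM1 pM2 | nfX].
  apply: contraNeq nfX => neq; apply/existsP; exists M1; apply/existsP; exists M2.
  by rewrite pM1 pM2 !modn2; move: neq; case: (odd _); case: (odd _).
apply/existsP=> -[M1 /existsP[M2 /and3P[pM1 pM2]]].
by rewrite !modn2 (nfX M1 M2) ?eqxx.
Qed.

Lemma nonfeasible_nabla A : nabla A \in nonfeasible_sets G.
Proof. by apply/nonfeasibleP=> M1 M2 pM1 pM2; rewrite !matching_nabla_odd. Qed.

Lemma nonfeasible_set0 : set0 \in nonfeasible_sets G.
Proof. by apply/nonfeasibleP=> M1 M2 _ _; rewrite !setI0. Qed.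

Lemma nonfeasible_setT : [set: edge G] \in nonfeasible_sets G.
Proof.
apply/nonfeasibleP=> M1 M2 pM1 pM2; rewrite !setIT; congr odd.
(* All perfect matchings have the same size, half the number of vertices. *)
have card2 M : perfect_matching M -> #|M| * 2 = #|vertex G|.
  move=> pM; rewrite -cardsT -(sum_matching_ends _ pM) -sum_nat_const.
  by apply: eq_bigr => e _; rewrite setIT card_ends.
by apply/eqP; rewrite -(@eqn_pmul2r 2) // !card2.
Qed.

Lemma switching_equiv_set0P X :
  reflect (exists A, X = nabla A) (switching_equiv X set0).
Proof.
have s0 A : symdiff set0 (nabla A) = nabla A.
  by apply/setP=> e; rewrite in_symdiff in_set0.
apply: (iffP existsP) => -[A defX]; exists A; first by rewrite (eqP defX) s0.
by rewrite s0 defX.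
Qed.

End Matchings.

(** * Bipartite graphs *)

Section Bipartite.

Variables (G : graph) (A : {set vertex G}) (l r : edge G -> vertex G).
Hypotheses (lA : forall e, l e \in A) (rA : forall e, r e \notin A).
Hypothesis endsE : forall e, ends e = [set l e; r e].
Implicit Types (M X : {set edge G}) (e f : edge G).

Lemma mem_endsA e v : v \in A -> (v \in ends e) = (v == l e).
Proof.
move=> vA; rewrite endsE !inE; case: (v =P r e) => [eq_v|]; rewrite ?orbF //.
by move: (rA e); rewrite -eq_v vA.
Qed.

Lemma mem_endsAC e v : v \notin A -> (v \in ends e) = (v == r e).
Proof.
move=> vA; rewrite endsE !inE; case: (v =P l e) => [eq_v|] //.
by move: (lA e); rewrite -eq_v (negPf vA).
Qed.

Section Matching.

Variables (M : {set edge G}) (m : vertex G -> edge G).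
Hypothesis mP : forall v e, (e \in M) && (v \in ends e) = (e == m v).

Lemma mate_in v : m v \in M.
Proof. by have := mP v (m v); rewrite eqxx => /andP[]. Qed.

Lemma mate_ends v : v \in ends (m v).
Proof. by have := mP v (m v); rewrite eqxx => /andP[]. Qed.

Lemma mate_uniq e v : e \in M -> v \in ends e -> m v = e.
Proof. by move=> eM ve; apply/esym/eqP; rewrite -mP eM. Qed.

Lemma l_mate v : v \in A -> l (m v) = v.
Proof. by move=> vA; apply/esym/eqP; rewrite -mem_endsA ?mate_ends. Qed.

Lemma r_mate v : v \notin A -> r (m v) = v.
Proof. by move=> vA; apply/esym/eqP; rewrite -mem_endsAC ?mate_ends. Qed.

Lemma mate_l e : e \in M -> m (l e) = e.
Proof. by move=> eM; apply: mate_uniq; rewrite // endsE !inE eqxx. Qed.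

Lemma mate_r e : e \in M -> m (r e) = e.
Proof. by move=> eM; apply: mate_uniq; rewrite // endsE !inE eqxx orbT. Qed.

(** The head of the arc [e] in the digraph on [A] obtained by contracting [M];
    its tail is [l e]. *)
Definition head e : vertex G := l (m (r e)).

Lemma head_r e f : head e = head f -> r e = r f.
Proof.
move=> /(congr1 m); rewrite /head !mate_l ?mate_in // => /(congr1 r).
by rewrite !r_mate.
Qed.

(** Exchange along an alternating cycle: the edges of [s] replace the matching edges at its nodes.
    Tails and heads of [s] form the same set of nodes, so on the side outside [A] the walk covers
    exactly the partners of these nodes. *)
Lemma alternating_cycle_matching a s :
    walk l head a s -> walk_end head a s = a -> uniq (map l s) ->
  perfect_matching [set e | (e \in s) || (e \in M) && (l e \notin map l s)].
Proof.
move=> ws es Ul; have peq := closed_walk_perm ws es.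
have Uh : uniq (map head s) by rewrite -(perm_uniq peq).
apply: perfect_matching_intro => [v | v e f].
  have [vA | vA] := boolP (v \in A).
    have [/mapP[e es' ->] | vs] := boolP (v \in map l s).
      by exists e; rewrite ?inE ?es' // endsE !inE eqxx.
    by exists (m v); rewrite ?mate_ends // inE mate_in l_mate // vs orbT.
  have [ls | ls] := boolP (l (m v) \in map l s).
    move: ls; rewrite (perm_mem peq) -{1}(r_mate vA) => /mapP[e es' /head_r].
    rewrite r_mate // => ->.
    by exists e; rewrite ?inE ?es' // endsE !inE eqxx orbT.
  by exists (m v); rewrite ?mate_ends // inE mate_in ls orbT.
(* An edge of the walk shares no vertex with a matching edge that is kept. *)
have new_old g h : g \in s -> h \in M -> l h \notin map l s ->
    v \in ends g -> v \in ends h -> g = h.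
  move=> gs hM hs; have [vA | vA] := boolP (v \in A).
    by rewrite !mem_endsA // => /eqP-> /eqP eq_l; rewrite -eq_l map_f in hs.
  rewrite !mem_endsAC // => /eqP-> /eqP eq_r.
  by move: hs; rewrite (perm_mem peq) -(mate_r hM) -eq_r map_f.
rewrite !inE => /orP[e_s | /andP[eM els]] /orP[f_s | /andP[fM fls]] ve vf.
- move: ve vf; have [vA | vA] := boolP (v \in A).
    rewrite !mem_endsA // => /eqP-> /eqP.
    exact: (uniq_map_inj_in Ul).
  rewrite !mem_endsAC // => /eqP-> /eqP eq_r.
  by apply: (uniq_map_inj_in Uh); rewrite // /head eq_r.
- exact: new_old.
- by apply/esym/new_old.
by rewrite -(mate_uniq eM ve) (mate_uniq fM vf).
Qed.

(** Compare [M] with the exchanged matching. Their common part [D] cancels, leaving the edges of [s]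
    against the matching edges at their tails. *)
Lemma alternating_cycle_even X a s :
    X \in nonfeasible_sets G ->
    walk l head a s -> walk_end head a s = a -> uniq (map l s) ->
  ~~ odd (count (fun e => (e \in X) (+) (m (l e) \in X)) s).
Proof.
move=> /nonfeasibleP nfX ws es Ul.
have pM : perfect_matching M by apply/perfect_matchingP; exists m.
have := nfX _ _ pM (alternating_cycle_matching ws es Ul).
set D := [set e in M | l e \notin map l s].
have Uml : uniq (map (m \o l) s).
  rewrite map_comp map_inj_in_uniq // => _ _ /mapP[e _ ->] /mapP[f _ ->].
  by move/(congr1 l); rewrite !l_mate.
have Uid : uniq (map id s) by rewrite map_id (map_uniq Ul).
have imset_idE : [set id e | e in s] = [set e in s].
  apply/setP=> e; rewrite inE; apply/imsetP/idP => [[f fs ->] // | es'].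
  by exists e.
have splitX (B C : {set edge G}) : [disjoint B & C] ->
    odd #|(B :|: C) :&: X| = odd #|B :&: X| (+) odd #|C :&: X|.
  move=> dBC; rewrite setIUl cardsU setIACA setIid.
  by rewrite (disjoint_setI0 dBC) set0I cards0 subn0 oddD.
have -> : [set e | (e \in s) || (e \in M) && (l e \notin map l s)]
            = [set id e | e in s] :|: D.
  by apply/setP=> e; rewrite imset_idE !inE.
have -> : M = [set (m \o l) e | e in s] :|: D.
  apply/setP=> e; rewrite !inE; apply/idP/orP => [eM | [/imsetP[f _ ->] | /andP[]//]].
    have [/mapP[f fs eq_l] | els] := boolP (l e \in map l s); last by right; rewrite eM.
    by left; apply/imsetP; exists f; rewrite //= -eq_l mate_l.
  exact: mate_in.
rewrite !splitX.
- rewrite !card_imset_seqI // => /addIb eq_odd.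
  by rewrite odd_count_addb eq_odd addbb.
- rewrite imset_idE; apply/pred0P=> e /=; rewrite !inE.
  by apply/negP=> /and3P[es' _ /negP[]]; rewrite map_f.
apply/pred0P=> e /=; rewrite !inE; apply/negP=> /and3P[/imsetP[f fs ->] _].
by rewrite /= l_mate // map_f.
Qed.

End Matching.

(* A perfect matching through [e] permutes the nodes of the digraph, and the
   orbit of [l e] under this permutation is a directed cycle through [e]. *)
Lemma connect_head M m M' e :
    (forall v e, (e \in M) && (v \in ends e) = (e == m v)) ->
    perfect_matching M' -> e \in M' ->
  connect (arc l (head m)) (head m e) (l e).
Proof.
move=> mP /perfect_matchingP[m' m'P] eM'.
(* Extending by the identity outside [A] gives an injective self-map of all vertices, whose orbits
   are therefore cycles. *)
pose f v := if v \in A then head m (m' v) else v.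
have fA v : v \in A -> f v = head m (m' v) by rewrite /f => ->.
have f_inj : injective f.
  move=> u v; rewrite /f; case: ifP => uA; case: ifP => vA //.
  - move/(head_r mP) => eq_r; rewrite -(l_mate m'P uA) -(l_mate m'P vA).
    by rewrite -(mate_r m'P (mate_in m'P u)) eq_r (mate_r m'P (mate_in m'P v)).
  - by move=> eq_v; rewrite -eq_v lA in vA.
  - by move=> eq_u; rewrite eq_u lA in uA.
have f_arc : subrel (frel f) (connect (arc l (head m))).
  move=> u v /= /eqP <-; have [uA | uA] := boolP (u \in A); last first.
    by rewrite /f (negPf uA) connect0.
  rewrite fA //; apply/connect1/existsP; exists (m' u).
  by rewrite (l_mate m'P uA) !eqxx.
apply: (connect_sub f_arc); rewrite fconnect_sym // -[e in head m e](mate_l m'P eM').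
by rewrite -fA // fconnect1.
Qed.

Lemma nonfeasible_cut M X :
    perfect_matching M -> (forall e, exists2 M', perfect_matching M' & e \in M') ->
    X \in nonfeasible_sets G ->
  exists B, X = nabla B.
Proof.
move=> /perfect_matchingP[m mP] covered nfX.
have [|a s ws es Us|p p_head] :=
    @potential_exists _ _ l (head m) (fun e => (e \in X) (+) (m (l e) \in X)).
- by move=> e; have [M' pM' eM'] := covered e; apply: (connect_head mP pM').
- exact: (alternating_cycle_even mP nfX ws es Us).
(* A vertex outside [A] takes the potential of its partner, so that [r e] gets [p (head m e)]. The
   correction by [m v \in X] on [A] cancels the matching term in the weight of [e], leaving
   [e \in X]. *)
exists [set v | if v \in A then p v (+) (m v \in X) else p (l (m v))].
apply/setP=> e; rewrite (in_nabla2 _ (endsE e)) !inE lA (negPf (rA e)).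
rewrite -/(head m e) p_head.
by case: (p _); case: (_ \in X); case: (_ \in X).
Qed.

End Bipartite.

Lemma bipartite_ends (G : graph) (A : {set vertex G}) :
    nabla A = [set: edge G] ->
  exists l r : edge G -> vertex G,
    [/\ forall e, l e \in A, forall e, r e \notin A
      & forall e, ends e = [set l e; r e]].
Proof.
move=> cutA.
have /fin_all_exists[lr lrP] e : exists uv : vertex G * vertex G,
    [/\ uv.1 \in A, uv.2 \notin A & ends e = [set uv.1; uv.2]].
  have : e \in nabla A by rewrite cutA inE.
  have [u [v def_e]] := ends2 e; rewrite (in_nabla2 _ def_e).
  have [uA | uA] := boolP (u \in A) => vA; first by exists (u, v).
  by exists (v, u); rewrite /= setUC.
by exists (fun e => (lr e).1), (fun e => (lr e).2); split=> e; have [] := lrP e.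
Qed.

Lemma bipartite_nonfeasible_cut (G : graph) (X : {set edge G}) :
    matching_covered G -> bipartite G -> X \in nonfeasible_sets G ->
  exists B, X = nabla B.
Proof.
case/andP=> _ /forallP covG /bipartiteP[A /bipartite_ends[l [r [lA rA endsE]]]].
have covered (e : edge G) : exists2 M, perfect_matching M & e \in M.
  by have /existsP[M /andP[]] := covG e; exists M.
(* Only an edge yields a perfect matching here: a single vertex is matching-covered but has none.
   Without edges, [X] is the empty cut. *)
have [e _ | no_edge _] := pickP (mem [set: edge G]).
  by have [M pM _] := covered e; apply: (nonfeasible_cut lA rA endsE pM).
by exists set0; apply/setP=> e; have := no_edge e; rewrite /= inE.
Qed.

Theorem theorem1p3 (G : graph) (HG : matching_covered G) :
  [<-> bipartite G;
       nonfeasible_sets G = [set X | switching_equiv X set0];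
       nonfeasible_sets G = [set X | switching_equiv X [set: edge G]]].
Proof.
tfae.
- move=> bipG; apply/setP=> X; rewrite [RHS]inE; apply/idP/switching_equiv_set0P.
    exact: bipartite_nonfeasible_cut.
  by case=> B ->; apply: nonfeasible_nabla.
(* Once all of [E] is the cut of [B], switching from [E] at a set amounts to switching from the
   empty set at its symmetric difference with [B]. *)
- move=> nfE; have := nonfeasible_setT G.
  rewrite nfE inE => /switching_equiv_set0P[B cutB].
  apply/setP=> X; rewrite !inE; apply/switching_equiv_set0P/existsP => -[C].
    move=> ->; exists [set v | (v \in B) (+) (v \in C)]; apply/eqP/setP=> e.
    by rewrite in_symdiff nabla_symdiff -cutB !inE addKb.
  move/eqP=> ->; exists [set v | (v \in B) (+) (v \in C)]; apply/setP=> e.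
  by rewrite in_symdiff nabla_symdiff -cutB.
(* The empty set arises from [E] by switching at some [B], which forces the cut of [B] to be [E]. *)
move=> nfE; have := nonfeasible_set0 G; rewrite nfE inE => /existsP[B /eqP cutB].
apply/bipartiteP; exists B; apply/setP=> e; move/setP/(_ e): cutB.
by rewrite in_symdiff !inE; case: (_ == 1).
Qed.
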